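(* Let $\{\rho_k\}$, $\{\mu_k\}$, $\{\epsilon_k\}$ be sequences of positive numbers with $\rho_k\to\infty$, $\mu_k\to\infty$ and $\epsilon_k\to0$. For each $k\ge0$, let $(x^k,y^k,z^k)$ be an $\epsilon_k$-optimal solution of the minimax problem $\min_{x,y}\max_zP_{\rho_k,\mu_k}(x,y,z)$. Then any accumulation point of $\{(x^k,y^k)\}$ is an optimal solution of the constrained bilevel problem $$\min_{x,y}\ f(x,y)\quad\text{s.t.}\quad y\in\operatorname{argmin}_z\{\tilde f(x,z):\tilde g(x,z)\le0\}.$$
   Context: Setting. $f(x,y)=f_1(x,y)+f_2(x)$ and $\tilde f(x,y)=\tilde f_1(x,y)+\tilde f_2(y)$ for $x\in\mathbb R^n$, $y\in\mathbb R^m$, where $f_2:\mathbb R^n\to\mathbb R\cup\{\infty\}$ and $\tilde f_2:\mathbb R^m\to\mathbb R\cup\{\infty\}$ are proper closed convex functions; $\mathcal X=\operatorname{dom}f_2$, $\mathcal Y=\operatorname{dom}\tilde f_2$. Assumption 1: (i) $f,\tilde f$ are continuous on $\mathcal X\times\mathcal Y$; $\tilde f_1(x,\cdot)$ is convex for every $x\in\mathcal X$; $f_1,\tilde f_1$ are respectively $L_{\nabla f_1}$- and $L_{\nabla\tilde f_1}$-smooth on $\mathcal X\times\mathcal Y$ (gradients Lipschitz there with these constants); (ii) the proximal operators of $f_2,\tilde f_2$ can be exactly evaluated; (iii) $\mathcal X,\mathcal Y$ are compact. Assumption 2: (i) $f$ and $\tilde f$ are $L_f$- and $L_{\tilde f}$-Lipschitz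 continuous on $\mathcal X\times\mathcal Y$, respectively; (ii) $\tilde g:\mathbb R^n\times\mathbb R^m\to\mathbb R^l$ is $L_{\nabla\tilde g}$-smooth (Lipschitz Jacobian, Frobenius norm) and $L_{\tilde g}$-Lipschitz continuous on $\mathcal X\times\mathcal Y$; (iii) $\tilde g_i(x,\cdot)$ is convex for each $i$, and for each $x\in\mathcal X$ there exists $\hat z_x\in\mathcal Y$ with $\tilde g_i(x,\hat z_x)<0$ for $i=1,\dots,l$, and $G:=\min\{-\tilde g_i(x,\hat z_x):x\in\mathcal X,\ i=1,\dots,l\}>0$. Assumption 3: there exist $\bar\theta>0$ and a non-decreasing function $\omega:\mathbb R_+\to\mathbb R_+$ with $\lim_{\theta\downarrow0}\omega(\theta)=0$ such that $\operatorname{dist}(z,\mathcal S_\theta(x))\le\omega(\theta)$ for all $x\in\mathcal X$, $z\in\mathcal S_0(x)$ and $\theta\in[0,\bar\theta]$, where $\mathcal S_\theta(x)=\operatorname{argmin}_z\{\tilde f(x,z):\|[\tilde g(x,z)]_+\|\le\theta\}$. All three assumptions hold. Here $v_+$ denotes the componentwise nonnegative part. For $\rho,\mu>0$, $\tilde P_\mu(x,z)=\tilde f(x,z)+\mu\|[\tilde g(x,z)]_+\|^2$ and $P_{\rho,\mu}(x,y,z)=f(x,y)+\rho(\tilde P_\mu(x,y)-\tilde P_\mu(x,z))$. Optimization over $(x,y)$ is effectively over $\mathcal X\times\mathcal Y$ and over $z$ effectively over $\mathcal Y$. For a minimax problem $\Psi^*=\min_u\max_v\Psi(u,v)$ with $\Psi^*$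 finite, $(u_\epsilon,v_\epsilon)$ is an $\epsilon$-optimal solution if $\max_v\Psi(u_\epsilon,v)-\Psi(u_\epsilon,v_\epsilon)\le\epsilon$ and $\Psi(u_\epsilon,v_\epsilon)-\Psi^*\le\epsilon$. This is applied with $u=(x,y)$, $v=z$. *)

(* Defs.v *)
From HB Require Import structures.
From mathcomp Require Import all_boot all_order all_algebra.
From mathcomp Require Import all_classical all_reals all_analysis.

Set Implicit Arguments.
Unset Strict Implicit.
Unset Printing Implicit Defensive.

Import Order.TTheory GRing.Theory Num.Theory.
Import numFieldNormedType.Exports.

Local Open Scope classical_set_scope.
Local Open Scope ring_scope.

(* Frobenius norm; on row vectors it is the Euclidean norm.  The library norm
   on matrices is the sup norm: it induces the same topology and the same notion
   of differentiability, but different Lipschitz constants and distances. *)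
Definition enorm (R : realType) (a b : nat) (A : 'M[R]_(a, b)) : R :=
  Num.sqrt (\sum_(i < a) \sum_(j < b) A i j ^+ 2).

Definition pospart (R : realType) (l : nat) (v : 'rV[R]_l) : 'rV[R]_l :=
  \row_i Num.max (v 0 i) 0.

(* Euclidean distance on R^n x R^m = R^(n + m). *)
Definition pdist (R : realType) (n m : nat) (p q : 'rV[R]_n * 'rV[R]_m) : R :=
  enorm (row_mx (p.1 - q.1) (p.2 - q.2)).

(* Distance to a set, equal to +oo when the set is empty. *)
Definition edist_set (R : realType) (m : nat) (z : 'rV[R]_m)
    (S : set 'rV[R]_m) : \bar R :=
  ereal_inf [set (enorm (z - s))%:E | s in S].

(* Minimizers of F over C.  With the requirement F z < +oo, the argmin of a
   function that is identically +oo on C is empty. *)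
Definition argmin (R : realType) (T : Type) (C : set T) (F : T -> \bar R) :
    set T :=
  [set z | [/\ C z, (F z < +oo)%E & forall z', C z' -> (F z <= F z')%E]].

Definition edom (R : realType) (T : Type) (h : T -> \bar R) : set T :=
  [set x | (h x < +oo)%E].

Definition proper_fun (R : realType) (T : Type) (h : T -> \bar R) : Prop :=
  (forall x, (-oo < h x)%E) /\ (edom h !=set0).

(* A function is closed when its epigraph is. *)
Definition closed_fun (R : realType) (n : nat) (h : 'rV[R]_n -> \bar R) : Prop :=
  closed [set p : 'rV[R]_n * R | (h p.1 <= p.2%:E)%E].

(* For h nowhere -oo; the convention 0 * +oo = 0 makes t = 0 and t = 1
   harmless. *)
Definition econvex_fun (R : realType) (n : nat) (h : 'rV[R]_n -> \bar R) : Prop :=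
  forall (x y : 'rV[R]_n) (t : R), 0 <= t <= 1 ->
    (h (t *: x + (1 - t) *: y)%R <= t%:E * h x + (1 - t)%:E * h y)%E.

Definition proper_closed_convex (R : realType) (n : nat)
    (h : 'rV[R]_n -> \bar R) : Prop :=
  [/\ proper_fun h, closed_fun h & econvex_fun h].

(* w = prox_{lam h}(v). *)
Definition is_prox (R : realType) (n : nat) (h : 'rV[R]_n -> \bar R) (lam : R)
    (v w : 'rV[R]_n) : Prop :=
  argmin setT
    (fun z => (h z + ((2 * lam)^-1 * enorm (z - v)%R ^+ 2)%:E)%E) w.

(* [prox] is an oracle that returns the exact value of every proximal map. *)
Definition prox_evaluable (R : realType) (n : nat)
    (h : 'rV[R]_n -> \bar R) : Prop :=
  exists prox : R -> 'rV[R]_n -> 'rV[R]_n,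
    forall (lam : R) (v : 'rV[R]_n), 0 < lam -> is_prox h lam v (prox lam v).

Definition gradient (R : realType) (n m : nat) (h : 'rV[R]_n * 'rV[R]_m -> R)
    (p : 'rV[R]_n * 'rV[R]_m) : 'rV[R]_(n + m) :=
  row_mx (\row_i 'D_(delta_mx 0 i, 0) h p) (\row_j 'D_(0, delta_mx 0 j) h p).

Definition pjacobian (R : realType) (n m l : nat)
    (h : 'rV[R]_n * 'rV[R]_m -> 'rV[R]_l) (p : 'rV[R]_n * 'rV[R]_m) :
    'M[R]_(l, n + m) :=
  \matrix_(i < l) gradient (fun q => h q 0 i) p.

Definition smooth_on (R : realType) (n m : nat) (D : set ('rV[R]_n * 'rV[R]_m))
    (L : R) (h : 'rV[R]_n * 'rV[R]_m -> R) : Prop :=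
  (forall p, D p -> differentiable h p) /\
  (forall p q, D p -> D q ->
    enorm (gradient h p - gradient h q) <= L * pdist p q).

Definition vsmooth_on (R : realType) (n m l : nat)
    (D : set ('rV[R]_n * 'rV[R]_m)) (L : R)
    (h : 'rV[R]_n * 'rV[R]_m -> 'rV[R]_l) : Prop :=
  (forall p, D p -> differentiable h p) /\
  (forall p q, D p -> D q ->
    enorm (pjacobian h p - pjacobian h q) <= L * pdist p q).

(* Only used for extended-valued functions that are finite on D. *)
Definition elip_on (R : realType) (n m : nat) (D : set ('rV[R]_n * 'rV[R]_m))
    (L : R) (h : 'rV[R]_n * 'rV[R]_m -> \bar R) : Prop :=
  forall p q, D p -> D q -> (`|h p - h q| <= (L * pdist p q)%:E)%E.

Definition vlip_on (R : realType) (n m l : nat) (D : set ('rV[R]_n * 'rV[R]_m))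
    (L : R) (h : 'rV[R]_n * 'rV[R]_m -> 'rV[R]_l) : Prop :=
  forall p q, D p -> D q -> enorm (h p - h q) <= L * pdist p q.

(* Data of the problem
     min_{x,y} f(x,y)  s.t.  y in argmin_z { ft(x,z) : gt(x,z) <= 0 }
   with f(x,y) = f1(x,y) + f2(x) and ft(x,y) = ft1(x,y) + ft2(y). *)
Record bilevel (R : realType) (n m l : nat) := Bilevel {
  up1 : 'rV[R]_n * 'rV[R]_m -> R ;
  up2 : 'rV[R]_n -> \bar R ;
  low1 : 'rV[R]_n * 'rV[R]_m -> R ;
  low2 : 'rV[R]_m -> \bar R ;
  lowg : 'rV[R]_n * 'rV[R]_m -> 'rV[R]_l ;
  up2P : proper_closed_convex up2 ;
  low2P : proper_closed_convex low2
}.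

Section Problem.
Variables (R : realType) (n m l : nat) (B : bilevel R n m l).

Definition upf (p : 'rV[R]_n * 'rV[R]_m) : \bar R := ((up1 B p)%:E + up2 B p.1)%E.

Definition lowf (p : 'rV[R]_n * 'rV[R]_m) : \bar R :=
  ((low1 B p)%:E + low2 B p.2)%E.

Definition domX : set 'rV[R]_n := edom (up2 B).
Definition domY : set 'rV[R]_m := edom (low2 B).
Definition domXY : set ('rV[R]_n * 'rV[R]_m) := domX `*` domY.

Definition relaxed_sol (theta : R) (x : 'rV[R]_n) : set 'rV[R]_m :=
  argmin [set z | enorm (pospart (lowg B (x, z))) <= theta]
         (fun z => lowf (x, z)).

Definition lower_sol (x : 'rV[R]_n) : set 'rV[R]_m :=
  argmin [set z | forall i, lowg B (x, z) 0 i <= 0] (fun z => lowf (x, z)).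

Definition bilevel_optimal (p : 'rV[R]_n * 'rV[R]_m) : Prop :=
  argmin [set q | lower_sol q.1 q.2] upf p.

Definition assumption1 (L1 Lt1 : R) : Prop :=
  [/\ {within domXY, continuous upf} /\ {within domXY, continuous lowf},
      forall x, domX x -> convex_function setT (fun z => low1 B (x, z)),
      smooth_on domXY L1 (up1 B) /\ smooth_on domXY Lt1 (low1 B),
      prox_evaluable (up2 B) /\ prox_evaluable (low2 B) &
      compact domX /\ compact domY].

(* The selection x |-> zhat x is arbitrary, so the minimum of the slacks need
   not be attained; only the positivity of their infimum is required. *)
Definition slater : Prop :=
  exists zhat : 'rV[R]_n -> 'rV[R]_m,
    (forall x, domX x ->
      domY (zhat x) /\ forall i, lowg B (x, zhat x) 0 i < 0) /\
    0 < inf [set r | exists x i, domX x /\ r = - lowg B (x, zhat x) 0 i].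

Definition assumption2 (Lf Ltf Lg Ljg : R) : Prop :=
  [/\ elip_on domXY Lf upf /\ elip_on domXY Ltf lowf,
      vsmooth_on domXY Ljg (lowg B) /\ vlip_on domXY Lg (lowg B),
      forall i x, domX x -> convex_function setT (fun z => lowg B (x, z) 0 i) &
      slater].

Definition assumption3 : Prop :=
  exists (thbar : R) (omega : R -> R),
    [/\ 0 < thbar,
        forall t, 0 <= t -> 0 <= omega t,
        forall s t, 0 <= s -> s <= t -> omega s <= omega t,
        omega t @[t --> 0^'+] --> (0 : R) &
        forall x z theta, domX x -> relaxed_sol 0 x z -> 0 <= theta <= thbar ->
          (edist_set z (relaxed_sol theta x) <= (omega theta)%:E)%E].

Definition penalty_low (mu : R) (p : 'rV[R]_n * 'rV[R]_m) : \bar R :=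
  (lowf p + (mu * enorm (pospart (lowg B p)) ^+ 2)%:E)%E.

Definition penalty (rho mu : R) (p : 'rV[R]_n * 'rV[R]_m) (z : 'rV[R]_m) :
    \bar R :=
  (upf p + rho%:E * (penalty_low mu p - penalty_low mu (p.1, z)))%E.

End Problem.

Definition max_value (R : realType) (U V : Type) (D : set V)
    (Psi : U -> V -> \bar R) (u : U) : \bar R :=
  ereal_sup [set Psi u v | v in D].

Definition minimax_value (R : realType) (U V : Type) (C : set U) (D : set V)
    (Psi : U -> V -> \bar R) : \bar R :=
  ereal_inf [set max_value D Psi u | u in C].

(* eps-optimal solution of min_{u in C} max_{v in D} Psi(u, v). *)
Definition minimax_eps_optimal (R : realType) (U V : Type) (C : set U)
    (D : set V) (Psi : U -> V -> \bar R) (eps : R) (u : U) (v : V) : Prop :=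
  [/\ minimax_value C D Psi \is a fin_num, C u, D v,
      (max_value D Psi u - Psi u v <= eps%:E)%E &
      (Psi u v - minimax_value C D Psi <= eps%:E)%E].

(* Main.v *)
Require Import Defs.
From HB Require Import structures.
From mathcomp Require Import all_boot all_order all_algebra.
From mathcomp Require Import all_classical all_reals all_analysis.
From mathcomp Require Import lra.

(** Write P_mu(x, z) = ft(x, z) + mu |[gt(x, z)]_+|^2 for the lower-level penalty
and u_k = (x_k, y_k).

The value of the minimax problem is bounded above by testing it at a
well-chosen point: if w minimizes P_mu(x0, .) over Y, then the inner maximum at
(x0, w) is just f(x0, w), whatever rho is.  Eliminating the minimax value from
the two inequalities of eps-optimality therefore gives, for every x0, every
such w and every z in Y,

  f(u_k) + rho_k (P_mu_k(u_k) - P_mu_k(x_k, z)) <= f(x0, w) + 2 eps_k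

([eps_optimal_gap]).  Everything else follows from this inequality, along a
filter on the indices that refines the filter at infinity and along which u_k
tends to the given accumulation point p ([cluster_subfilter]).

- As f is bounded on the compact X x Y and rho_k -> oo, y_k minimizes
  P_mu_k(x_k, .) up to an arbitrarily small error ([penalized_le_near]).
- Comparing y_k with a feasible point bounds mu_k |[gt(u_k)]_+|^2, so
  mu_k -> oo makes p feasible ([limit_feasible]).
- Comparing y_k with a point z that is strictly feasible at p.1, hence still
  feasible at x_k for u_k near p, gives ft(p) <= ft(p.1, z)
  ([limit_le_strict]).  A feasible z is a limit of strictly feasible points of
  the segment from z to a Slater point, so p.2 solves the lower-level problem at
  p.1 ([limit_lower_argmin]).
- Taking z = y_k leaves f(u_k) <= f(x0, w) + 2 eps_k.  A minimizer w of
  P_mu_k(x0, .) solves the relaxed lower problem whose level theta is its own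
  violation, theta tends to 0 as mu_k -> oo, and every solution s of that
  relaxed problem is again a minimizer of P_mu_k(x0, .).  The continuity of the
  relaxed solution sets at theta = 0 thus allows w to be replaced by a point s
  close to any given solution z0 of the lower problem at x0, whence
  f(p) <= f(x0, z0) ([limit_upper_le]).  The point z0 itself
  would be a poor test point: the minimum of P_mu_k(x0, .) lies below ft(x0, z0),
  and the inner maximum at (x0, z0) multiplies this gap by rho_k.

The limit argument is carried out in normed spaces, for real-valued functions
that are Lipschitz for the ambient norms; the last part translates the
extended-valued data and Euclidean distances of the problem to that setting. *)

Set Implicit Arguments.
Unset Strict Implicit.
Unset Printing Implicit Defensive.

Import Order.TTheory GRing.Theory Num.Theory.
Import numFieldNormedType.Exports.
Local Open Scope classical_set_scope.
Local Open Scope ring_scope.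

(** * Euclidean norms and constraint violation *)

Section EuclideanNorm.
Context {R : realType}.
Implicit Types a b n m l : nat.

Lemma enorm_ge0 a b (A : 'M[R]_(a, b)) : 0 <= enorm A.
Proof. exact: sqrtr_ge0. Qed.

Lemma enorm_sqr a b (A : 'M[R]_(a, b)) :
  enorm A ^+ 2 = \sum_i \sum_j A i j ^+ 2.
Proof.
rewrite sqr_sqrtr // sumr_ge0 // => i _; rewrite sumr_ge0 // => j _.
exact: sqr_ge0.
Qed.

Lemma sqr_entry_le a b (A : 'M[R]_(a, b)) i j : A i j ^+ 2 <= enorm A ^+ 2.
Proof.
rewrite enorm_sqr (bigD1 i) //= (bigD1 j) //= -addrA lerDl addr_ge0 ?sumr_ge0//.
- by move=> k _; exact: sqr_ge0.
- by move=> k _; rewrite sumr_ge0 // => ? _; exact: sqr_ge0.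
Qed.

Lemma norm_le_enorm a b (A : 'M[R]_(a, b)) : `|A| <= enorm A.
Proof.
have [->|A0] := eqVneq `|A| 0; first exact: enorm_ge0.
have [[i j] /= Aij] := mx_norm_neq0 A0.
rewrite [X in X <= _]Aij.
rewrite -(ler_pXn2r (ltn0Sn 1)) ?nnegrE ?normr_ge0 ?enorm_ge0//.
by rewrite real_normK ?num_real ?sqr_entry_le.
Qed.

Lemma entry_le_norm a b (A : 'M[R]_(a, b)) i j : `|A i j| <= `|A|.
Proof.
rewrite {2}/Num.norm /= mx_normrE.
exact: (le_bigmax _ (fun ij => `|A ij.1 ij.2|) (i, j)).
Qed.

(** The constant is not sharp (the square root of [a * b] would be): only the
equivalence of the two norms matters below. *)
Lemma enorm_le_norm a b (A : 'M[R]_(a, b)) : enorm A <= (a * b)%:R * `|A|.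
Proof.
have h : 0 <= (a * b)%:R * `|A| :> R by rewrite mulr_ge0.
rewrite -(ler_pXn2r (ltn0Sn 1)) ?nnegrE ?enorm_ge0//.
have [s0|s1] := posnP (a * b)%N.
  have -> : enorm A = 0.
    rewrite /enorm big1 ?sqrtr0 // => i _; rewrite big1 // => j _.
    by move: (ltn_ord i) (ltn_ord j); case: a b A i j {h} s0 => [|a] [|b].
  by rewrite expr0n /= sqr_ge0.
apply: (@le_trans _ _ ((a * b)%:R * `|A| ^+ 2)).
  rewrite enorm_sqr.
  apply: (@le_trans _ _ (\sum_(i < a) \sum_(j < b) `|A| ^+ 2)).
    apply: ler_sum => i _; apply: ler_sum => j _.
    by rewrite -[A i j ^+ 2]real_normK ?num_real// lerXn2r ?nnegrE ?entry_le_norm.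
  by rewrite !sumr_const !card_ord -mulrnA mulr_natl mulnC.
by rewrite exprMn ler_wpM2r ?sqr_ge0// expr2 ler_peMl// ?ler1n.
Qed.

Lemma pdist_le n m (p q : 'rV[R]_n * 'rV[R]_m) :
  pdist p q <= (n + m)%:R * `|p - q|.
Proof.
apply: (le_trans (enorm_le_norm _)); rewrite mul1n ler_wpM2l //.
rewrite [X in X <= _]/Num.norm /= mx_normrE; apply: bigmax_le => // -[i j] _ /=.
rewrite prod_normE le_max.
case: (split_ordP j) => k ->.
- by rewrite row_mxEl entry_le_norm.
- by rewrite row_mxEr entry_le_norm orbT.
Qed.

Lemma enorm_pospart_sqr l (v : 'rV[R]_l) :
  enorm (pospart v) ^+ 2 = \sum_j Num.max (v 0 j) 0 ^+ 2.
Proof.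
by rewrite enorm_sqr big_ord1; apply: eq_bigr => j _; rewrite mxE.
Qed.

Lemma enorm_pospart_eq0 l (v : 'rV[R]_l) :
  enorm (pospart v) = 0 <-> forall i, v 0 i <= 0.
Proof.
split=> [v0 i|v0].
  have := sqr_entry_le (pospart v) 0 i.
  rewrite v0 expr0n /= mxE => h.
  have /eqP : Num.max (v 0 i) 0 ^+ 2 == 0 by rewrite eq_le h sqr_ge0.
  by move/eqP; rewrite sqrf_eq0 => /eqP/max_idPr.
apply/eqP; rewrite -sqrf_eq0 enorm_pospart_sqr big1 // => i _.
by rewrite (max_idPr (v0 i)) expr0n.
Qed.

Lemma continuous_enorm_pospart_sqr l :
  continuous (fun v : 'rV[R]_l => enorm (pospart v) ^+ 2).
Proof.
under [X in continuous X]eq_fun do rewrite enorm_pospart_sqr.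
apply: continuous_big => [|i _ v]; first exact: add_continuous.
have c : {for v, continuous (fun w : 'rV[R]_l => Num.max (w 0 i) 0)}.
  apply: (@continuous_max R 'rV[R]_l (fun w => w 0 i) (fun=> 0)).
    exact: coord_continuous.
  exact: (@cst_continuous 'rV[R]_l R 0 v).
exact: (cvgM c c).
Qed.

End EuclideanNorm.

(** * Lipschitz functions and cluster points *)

Section Convergence.
Context {R : realType}.

Lemma klipschitz_le (V W : normedModType R) (C : R) (A : set V)
    (f : V -> W) p q :
  C.-lipschitz_A f -> A p -> A q -> `|f p - f q| <= C * `|p - q|.
Proof. by move=> fC Ap Aq; exact: (fC (p, q) (conj Ap Aq)). Qed.

Lemma klipschitz_cvg (V W : normedModType R) (C : R) (A : set V) (f : V -> W)
    (I : Type) (G : set_system I) {FG : Filter G} (u : I -> V) (p : V) :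
  C.-lipschitz_A f -> A p -> (\forall i \near G, A (u i)) ->
  u i @[i --> G] --> p -> f (u i) @[i --> G] --> f p.
Proof.
move=> fC Ap Au /cvgrPdist_le up; apply/cvgrPdist_le => e e0.
have C0 : 0 < `|C| + 1 by rewrite ltr_wpDl.
near=> i.
have Aui : A (u i) by near: i.
apply: (le_trans (klipschitz_le fC Ap Aui)).
apply: (@le_trans _ _ ((`|C| + 1) * `|p - u i|)).
  by rewrite ler_wpM2r // ler_wpDr // ler_norm.
rewrite mulrC -ler_pdivlMr //.
by near: i; apply: up; rewrite divr_gt0.
Unshelve. all: by end_near. Qed.

Lemma compact_klipschitz_oscillation (V W : normedModType R) (C : R) (A : set V)
    (f : V -> W) : compact A -> C.-lipschitz_A f ->
  exists M : R, forall p q, A p -> A q -> `|f p - f q| <= M.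
Proof.
move=> /compact_bounded[M [_ AM]] fC.
exists (`|C| * ((M + 1) + (M + 1))) => p q Ap Aq.
have M1 : M < M + 1 by rewrite ltrDl.
apply: (le_trans (klipschitz_le fC Ap Aq)).
apply: (@le_trans _ _ (`|C| * `|p - q|)); first by rewrite ler_wpM2r // ler_norm.
rewrite ler_wpM2l // (le_trans (ler_normB _ _)) // lerD //.
- exact: (AM _ M1 p).
- exact: (AM _ M1 q).
Qed.

(** The sets that contain almost all indices [i] for which [u i] is close to [p]
form a proper filter, since [u] comes close to [p] frequently.  It plays the
role of a convergent subsequence. *)
Lemma cluster_subfilter (V : topologicalType) (I : Type) (H : set_system I)
    {FH : Filter H} (u : I -> V) (p : V) : cluster (u i @[i --> H]) p ->
  exists G : set_system I,
    [/\ ProperFilter G, G `=>` H & u i @[i --> G] --> p].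
Proof.
move=> up.
pose G : set_system I :=
  [set A | exists2 B, nbhs p B & \forall i \near H, B (u i) -> A i].
exists G; split.
- split.
    move=> [B pB uB].
    have [v [/= v0 Bv]] := up [set v | ~ B v] B uB pB.
    exact: v0.
  split.
  + by exists setT; [exact: filterT|exact: nearW].
  + move=> P Q [B pB uP] [D pD uQ]; exists (B `&` D); first exact: filterI.
    by apply: filterS2 uP uQ => i hP hQ [/hP ? /hQ].
  + move=> P Q PQ [B pB uP]; exists B => //.
    by apply: filterS uP => i hP /hP/PQ.
- by move=> A HA; exists setT; [exact: filterT|apply: filterS HA].
- by move=> B pB; exists B => //; exact: nearW.
Qed.

End Convergence.

(** * Minimizers of the penalized lower-level problem *)

Section PenaltyLimit.
Context {R : realType} {U V : normedModType R} {l : nat}.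
Variables (X : set U) (Y : set V) (F T : U * V -> R) (g : U * V -> 'rV[R]_l).

Definition penalized (mu : R) (p : U * V) : R :=
  T p + mu * enorm (pospart (g p)) ^+ 2.

Definition penalty_argmin (mu : R) (x : U) (w : V) : Prop :=
  Y w /\ forall z, Y z -> penalized mu (x, w) <= penalized mu (x, z).

Definition relaxed_argmin (theta : R) (x : U) (s : V) : Prop :=
  [/\ Y s, enorm (pospart (g (x, s))) <= theta &
      forall z, Y z -> enorm (pospart (g (x, z))) <= theta ->
        T (x, s) <= T (x, z)].

(** [w] solves the problem relaxed to the level of its own violation, so any
other solution [s] of that relaxed problem has neither a larger objective nor a
larger violation than [w]. *)
Lemma penalty_argmin_relaxed mu x w s :
  0 < mu -> penalty_argmin mu x w ->
  relaxed_argmin (enorm (pospart (g (x, w)))) x s -> penalty_argmin mu x s.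
Proof.
move=> mu0 [Yw wmin] [Ys sw smin]; split=> // z Yz.
apply: le_trans (wmin z Yz); apply: lerD; first exact: smin.
by rewrite (ler_wpM2l (ltW mu0)) // lerXn2r ?nnegrE ?enorm_ge0.
Qed.

(** A feasible [z] pays no penalty; this is what makes the violation of penalty
minimizers vanish as [mu] grows. *)
Lemma penalty_argmin_violation mu x w z : penalty_argmin mu x w -> Y z ->
  enorm (pospart (g (x, z))) = 0 ->
  mu * enorm (pospart (g (x, w))) ^+ 2 <= T (x, z) - T (x, w).
Proof.
move=> [Yw wmin] Yz z0; rewrite lerBrDl; have := wmin z Yz.
by rewrite /penalized z0 expr0n /= mulr0 addr0.
Qed.

Variable C : R.
Hypothesis compactX : compact X.
Hypothesis compactY : compact Y.
Hypothesis lipF : C.-lipschitz_(X `*` Y) F.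
Hypothesis lipT : C.-lipschitz_(X `*` Y) T.
Hypothesis lipg : C.-lipschitz_(X `*` Y) g.

Lemma penalty_argmin_exists mu x : X x -> Y !=set0 ->
  exists w, penalty_argmin mu x w.
Proof.
move=> Xx Y0.
have pc : {within Y, continuous (fun z => penalized mu (x, z))}.
  apply/subspace_continuousP => z Yz.
  have Yn : \forall i \near within Y (nbhs z), (X `*` Y) (x, i).
    by apply: filterS (withinT Y _) => i Yi; split.
  have zz : (x, i) @[i --> within Y (nbhs z)] --> (x, z).
    by apply: cvg_pair; [exact: cvg_cst|exact: cvg_within].
  apply: cvgD.
    exact: (klipschitz_cvg lipT (conj Xx Yz : (X `*` Y) (x, z)) Yn zz).
  apply: cvgM; first exact: cvg_cst.
  have gz : g (x, i) @[i --> within Y (nbhs z)] --> g (x, z).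
    exact: (klipschitz_cvg lipg (conj Xx Yz : (X `*` Y) (x, z)) Yn zz).
  exact: (cvg_comp _ (fun v => enorm (pospart v) ^+ 2) gz
    (@continuous_enorm_pospart_sqr R l (g (x, z)))).
have [w wY wmin] := compact_EVT_min Y0 compactY pc.
by exists w; split=> [|z Yz]; [exact: set_mem|apply: wmin; exact: mem_set].
Qed.

(** * The limit of approximate penalty solutions *)

Variables (rho mu eps : nat -> R) (u : nat -> U * V).
Hypothesis mu_gt0 : forall k, 0 < mu k.
Hypothesis u_dom : forall k, (X `*` Y) (u k).

(** The form in which approximate optimality of [u k] is used: the minimax value
is eliminated, [(x0, w)] is the test point that bounds it, and [z] competes in
the inner maximum. *)
Hypothesis penalty_gap : forall k x0 w z,
  X x0 -> penalty_argmin (mu k) x0 w -> Y z ->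
  F (u k) + rho k * (penalized (mu k) (u k) - penalized (mu k) ((u k).1, z))
    <= F (x0, w) + 2 * eps k.

Variables (G : set_system nat) (p : U * V).
Context {FG : ProperFilter G}.
Hypothesis rho_oo : rho k @[k --> G] --> +oo.
Hypothesis mu_oo : mu k @[k --> G] --> +oo.
Hypothesis eps_0 : eps k @[k --> G] --> (0 : R).
Hypothesis u_p : u k @[k --> G] --> p.

Hypothesis slater : forall x, X x ->
  exists2 z, Y z & forall i, g (x, z) 0 i < 0.
Hypothesis convexY : forall a b t, Y a -> Y b -> 0 <= t <= 1 ->
  Y (t *: a + (1 - t) *: b).
Hypothesis convexg : forall x i a b t, X x -> 0 <= t <= 1 ->
  g (x, t *: a + (1 - t) *: b) 0 i <= t * g (x, a) 0 i + (1 - t) * g (x, b) 0 i.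

(** The test point is a minimizer of the penalty at [(u k).1] itself: [rho k]
times the suboptimality of [(u k).2] is then at most the oscillation of [F] plus
[2 * eps k]. *)
Lemma penalized_le_near d : 0 < d -> \forall k \near G, forall z, Y z ->
  penalized (mu k) (u k) <= penalized (mu k) ((u k).1, z) + d.
Proof.
move=> d0.
have [M FM] :=
  compact_klipschitz_oscillation (compact_setX compactX compactY) lipF.
near=> k => z Yz.
have [Xu Yu] := u_dom k.
have [w wP] := penalty_argmin_exists (mu k) Xu (ex_intro _ z Yz).
have gap := penalty_gap Xu wP Yz.
have Fle : F ((u k).1, w) - F (u k) <= M.
  by rewrite (le_trans (ler_norm _)) // FM //; split=> //; case: wP.
have epsk : eps k <= 1.
  by near: k; apply: (cvgr_le _ eps_0).
(* [2] bounds [2 * eps k]; the absolute value makes the bound on [rho k]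
   positive. *)
have rhoM : (`|M| + 2) / d <= rho k.
  by near: k; apply: (cvgryPge _).1 rho_oo _.
rewrite ler_pdivrMr // in rhoM.
have rho0 : 0 < rho k.
  rewrite -(pmulr_lgt0 _ d0); apply: lt_le_trans rhoM.
  by rewrite ltr_wpDl.
rewrite -lerBlDl -(ler_pM2l rho0).
have := ler_norm M.
lra.
Unshelve. all: by end_near. Qed.

Lemma limit_dom : X p.1 /\ Y p.2.
Proof.
have cD : closed (X `*` Y).
  apply: compact_closed; first exact: norm_hausdorff.
  exact: compact_setX.
by apply: (closed_cvg _ cD _ _ u_p); exact: nearW.
Qed.

(** At a Slater point of [(u k).1] the penalty vanishes, so [mu k] times the
squared violation of [u k] is bounded by the oscillation of [T] plus [1]. *)
Lemma limit_feasible i : g p 0 i <= 0.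
Proof.
have [M TM] :=
  compact_klipschitz_oscillation (compact_setX compactX compactY) lipT.
have gp : g (u k) 0 i @[k --> G] --> g p 0 i.
  have gp : g (u k) @[k --> G] --> g p.
    by apply: (klipschitz_cvg lipg limit_dom _ u_p); exact: nearW.
  exact: (cvg_comp _ (fun v : 'rV[R]_l => v 0 i) gp
    (@coord_continuous _ _ _ _ _ _)).
apply/ler_addgt0Pr => e e0; rewrite add0r.
apply: (cvgr_to_le gp); near=> k.
have [Xu Yu] := u_dom k.
have [z Yz z0] := slater Xu.
have gapk : forall z, Y z ->
    penalized (mu k) (u k) <= penalized (mu k) ((u k).1, z) + 1.
  by near: k; exact: penalized_le_near.
have := gapk z Yz; rewrite /penalized.
rewrite ((enorm_pospart_eq0 _).2 (fun j => ltW (z0 j))) expr0n /= mulr0 addr0.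
move=> gapz.
have Tle : T ((u k).1, z) - T (u k) <= M.
  by rewrite (le_trans (ler_norm _)) // TM.
have muM : (M + 1) / e ^+ 2 <= mu k.
  by near: k; apply: (cvgryPge _).1 mu_oo _.
rewrite ler_pdivrMr ?exprn_gt0 // in muM.
have : enorm (pospart (g (u k))) ^+ 2 <= e ^+ 2.
  by rewrite -(ler_pM2l (mu_gt0 k)); lra.
move/(le_trans (sqr_entry_le (pospart (g (u k))) 0 i)).
rewrite mxE ler_pXn2r ?nnegrE ?le_max ?lexx ?orbT ?(ltW e0) //.
by rewrite ge_max => /andP[].
Unshelve. all: by end_near. Qed.

(** Strict feasibility survives a small change of the first variable, which is
what allows [z] to compete with [(u k).2] at [(u k).1]. *)
Lemma limit_le_strict z : Y z -> (forall i, g (p.1, z) 0 i < 0) ->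
  T p <= T (p.1, z).
Proof.
move=> Yz gz; have [Xp Yp] := limit_dom.
have Dz : \forall k \near G, (X `*` Y) ((u k).1, z).
  by apply: nearW => k; split=> //; case: (u_dom k).
have uz : ((u k).1, z) @[k --> G] --> (p.1, z).
  by apply: cvg_pair; [exact: (cvg_comp _ fst u_p cvg_fst)|exact: cvg_cst].
have Tu : T (u k) @[k --> G] --> T p.
  by apply: (klipschitz_cvg lipT limit_dom _ u_p); exact: nearW.
have Tz : T ((u k).1, z) @[k --> G] --> T (p.1, z).
  exact: (klipschitz_cvg lipT (conj Xp Yz : (X `*` Y) (p.1, z)) Dz uz).
have gzk : g ((u k).1, z) @[k --> G] --> g (p.1, z).
  exact: (klipschitz_cvg lipg (conj Xp Yz : (X `*` Y) (p.1, z)) Dz uz).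
apply/ler_addgt0Pr => d d0.
apply: (ler_cvg_to Tu (cvgD Tz (cvg_cst d))); near=> k.
have gapk : forall z, Y z ->
    penalized (mu k) (u k) <= penalized (mu k) ((u k).1, z) + d.
  by near: k; exact: penalized_le_near.
have gle : forall i, g ((u k).1, z) 0 i <= 0.
  near: k; apply: filter_forall => i.
  have gi := cvg_comp _ (fun v : 'rV[R]_l => v 0 i) gzk
    (@coord_continuous _ _ _ _ _ _).
  exact: (cvgr_le _ gi).
have := gapk z Yz.
rewrite /penalized ((enorm_pospart_eq0 _).2 gle) expr0n /= mulr0 addr0.
apply: le_trans; rewrite lerDl mulr_ge0 ?sqr_ge0 //.
exact: ltW.
Unshelve. all: by end_near. Qed.

(** A feasible [z] is approached by the strictly feasible points
[t *: zh + (1 - t) *: z], where [zh] is a Slater point at [p.1]; convexity of the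
constraints makes them strictly feasible for [0 < t]. *)
Lemma limit_lower_argmin : relaxed_argmin 0 p.1 p.2.
Proof.
have [Xp Yp] := limit_dom; rewrite /relaxed_argmin -surjective_pairing.
split=> //; first by rewrite ((enorm_pospart_eq0 _).2 limit_feasible).
move=> z Yz z0.
have gz : forall i, g (p.1, z) 0 i <= 0.
  by apply/enorm_pospart_eq0/le_anti; rewrite z0 enorm_ge0.
have [zh Yzh gzh] := slater Xp.
apply/ler_addgt0Pr => e e0.
(* [T] grows by at most [t * K] from [z] to the point of parameter [t]. *)
pose K := `|C| * `|zh - z| + 1.
have K0 : 0 < K by rewrite ltr_wpDl // mulr_ge0.
pose t := Num.min 1 (e / K).
have t0 : 0 < t by rewrite lt_min ltr01 divr_gt0.
have t1 : t <= 1 by rewrite ge_min lexx.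
have tK : t * K <= e by rewrite -ler_pdivlMr // ge_min lexx orbT.
have t01 : 0 <= t <= 1 by rewrite (ltW t0).
pose zt := t *: zh + (1 - t) *: z.
have Yzt : Y zt by exact: convexY.
apply: (@le_trans _ _ (T (p.1, zt))).
  apply: limit_le_strict => // i.
  apply: (le_lt_trans (convexg i zh z Xp t01)).
  have h1 : t * g (p.1, zh) 0 i < 0 by rewrite pmulr_rlt0.
  have h2 : (1 - t) * g (p.1, z) 0 i <= 0 by rewrite mulr_ge0_le0 // subr_ge0.
  lra.
have lipz : `|T (p.1, zt) - T (p.1, z)| <= C * `|(p.1, zt) - (p.1, z)|.
  by apply: (klipschitz_le lipT); split.
have ztE : `|(p.1, zt) - (p.1, z)| = t * `|zh - z|.
  rewrite prod_normE /= subrr normr0 (max_idPr _) //.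
  have -> : zt - z = t *: (zh - z).
    by rewrite /zt scalerBl scale1r scalerBr addrA addrAC addrK.
  by rewrite normrZ gtr0_norm.
rewrite ztE in lipz.
have h3 : C * (t * `|zh - z|) <= t * K.
  rewrite /K mulrDr mulr1 mulrCA.
  apply: (@le_trans _ _ (t * (`|C| * `|zh - z|))).
    by rewrite ler_wpM2l ?(ltW t0) // ler_wpM2r // ler_norm.
  by rewrite lerDl (ltW t0).
have := ler_norm (T (p.1, zt) - T (p.1, z)).
lra.
Qed.

(** The violation of a penalty minimizer at [x0] tends to 0, so relaxed solutions
near [z0] at that level exist; being penalty minimizers too, they are valid test
points, and taking [z = (u k).2] cancels the term in [rho k]. *)
Lemma limit_upper_le x0 z0 : X x0 -> relaxed_argmin 0 x0 z0 ->
  (forall d, 0 < d -> exists2 theta0, 0 < theta0 &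
    forall theta, 0 <= theta <= theta0 ->
      exists2 s, relaxed_argmin theta x0 s & `|z0 - s| <= d) ->
  F p <= F (x0, z0).
Proof.
move=> Xx0 [Yz0 gz0 z0min] stable.
have [M TM] :=
  compact_klipschitz_oscillation (compact_setX compactX compactY) lipT.
have z00 : enorm (pospart (g (x0, z0))) = 0.
  by apply/le_anti; rewrite gz0 enorm_ge0.
have Fu : F (u k) @[k --> G] --> F p.
  by apply: (klipschitz_cvg lipF limit_dom _ u_p); exact: nearW.
apply/ler_addgt0Pr => e e0.
have K0 : 0 < `|C| + 1 + 2 by rewrite -addrA ltr_wpDl.
(* [e] has to absorb [`|C| * d] for the distance of [s] to [z0] and [2 * d] for
   [2 * eps k]. *)
pose d := e / (`|C| + 1 + 2).
have d0 : 0 < d by rewrite divr_gt0.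
have dE : e = d * (`|C| + 1 + 2) by rewrite mulfVK // gt_eqF.
have [th0 th00 thP] := stable d d0.
apply: (cvgr_to_le Fu); near=> k.
have [w wP] := penalty_argmin_exists (mu k) Xx0 (ex_intro _ z0 Yz0).
have Yw : Y w by case: wP.
have viol : mu k * enorm (pospart (g (x0, w))) ^+ 2 <= M.
  apply: le_trans (penalty_argmin_violation wP Yz0 z00) _.
  by rewrite (le_trans (ler_norm _)) // TM.
have muM : M / th0 ^+ 2 <= mu k.
  by near: k; apply: (cvgryPge _).1 mu_oo _.
rewrite ler_pdivrMr ?exprn_gt0 // in muM.
have wth : 0 <= enorm (pospart (g (x0, w))) <= th0.
  rewrite enorm_ge0 /= -(ler_pXn2r (ltn0Sn 1)) ?nnegrE ?enorm_ge0 ?(ltW th00) //.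
  by rewrite -(ler_pM2l (mu_gt0 k)) (le_trans viol).
have [s sP zs] := thP _ wth.
have Ys : Y s by case: sP.
have sarg := penalty_argmin_relaxed (mu_gt0 k) wP sP.
have [Xu Yu] := u_dom k.
have := penalty_gap Xx0 sarg Yu.
rewrite -surjective_pairing subrr mulr0 addr0 => /le_trans; apply.
have epsk : eps k <= d by near: k; apply: (cvgr_le _ eps_0).
have lips : `|F (x0, s) - F (x0, z0)| <= C * `|(x0, s) - (x0, z0)|.
  by apply: (klipschitz_le lipF); split.
rewrite prod_normE /= subrr normr0 (max_idPr _) // [`|s - z0|]distrC in lips.
have h3 : C * `|z0 - s| <= `|C| * d.
  apply: (@le_trans _ _ (`|C| * `|z0 - s|)).
    by rewrite ler_wpM2r // ler_norm.
  by rewrite ler_wpM2l.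
have := ler_norm (F (x0, s) - F (x0, z0)).
rewrite dE.
lra.
Unshelve. all: by end_near. Qed.

End PenaltyLimit.

(** * Reduction of the bilevel problem to real-valued Lipschitz data *)

Section ExtendedReal.
Context {R : realType}.

Lemma convex_edom n (h : 'rV[R]_n -> \bar R) a b t :
  econvex_fun h -> edom h a -> edom h b -> 0 <= t <= 1 ->
  edom h (t *: a + (1 - t) *: b).
Proof.
move=> hc ha hb t01; apply: le_lt_trans (hc a b t t01) _.
have /andP[t0 t1] := t01.
by apply: lte_add_pinfty; apply: lte_mul_pinfty => //; rewrite lee_fin // subr_ge0.
Qed.

Lemma convex_functionE (n : nat) (h : 'rV[R]_n -> R) a b (t : R) :
  convex_function setT h -> 0 <= t <= 1 ->
  h (t *: a + (1 - t) *: b) <= t * h a + (1 - t) * h b.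
Proof.
move=> hc /andP[t0 t1].
have := hc (Itv01 t0 t1) a b; rewrite !in_setT => /(_ isT isT).
exact.
Qed.

Lemma mul_pdist_le n m (L C : R) (p q : 'rV[R]_n * 'rV[R]_m) :
  `|L| * (n + m)%:R <= C -> L * pdist p q <= C * `|p - q|.
Proof.
move=> LC; apply: (@le_trans _ _ (`|L| * pdist p q)).
  by rewrite ler_wpM2r ?ler_norm // enorm_ge0.
apply: (@le_trans _ _ (`|L| * ((n + m)%:R * `|p - q|))).
  by rewrite ler_wpM2l // pdist_le.
by rewrite mulrA ler_wpM2r.
Qed.

Lemma elip_klipschitz n m D (L C : R) (h : 'rV[R]_n * 'rV[R]_m -> \bar R) :
  (forall p, D p -> h p \is a fin_num) -> elip_on D L h ->
  `|L| * (n + m)%:R <= C -> C.-lipschitz_D (fine \o h).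
Proof.
move=> hfin hL LC -[p q] [/= Dp Dq]; apply: le_trans (mul_pdist_le p q LC).
have := hL p q Dp Dq.
by rewrite -(fineK (hfin _ Dp)) -(fineK (hfin _ Dq)) -EFinB abse_EFin lee_fin.
Qed.

Lemma vlip_klipschitz n m l D (L C : R) (h : 'rV[R]_n * 'rV[R]_m -> 'rV[R]_l) :
  vlip_on D L h -> `|L| * (n + m)%:R <= C -> C.-lipschitz_D h.
Proof.
move=> hL LC -[p q] [/= Dp Dq]; apply: le_trans (mul_pdist_le p q LC).
exact: le_trans (norm_le_enorm _) (hL p q Dp Dq).
Qed.

End ExtendedReal.

Section BilevelData.
Context {R : realType} {n m l : nat} (B : bilevel R n m l).

Lemma upf_fin p : domX B p.1 -> upf B p \is a fin_num.
Proof.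
move=> Xp; have [[ninf _] _ _] := up2P B.
by rewrite /upf fin_numD /= fin_numElt ninf.
Qed.

Lemma upf_ltyP p : (upf B p < +oo)%E <-> domX B p.1.
Proof.
rewrite /upf /domX /edom /=; split; last first.
  by move=> h; apply: lte_add_pinfty; rewrite ?ltry.
by case: (up2 B p.1) => [r| |] //= _; rewrite ?ltry ?ltNyr.
Qed.

Lemma lowf_fin p : domY B p.2 -> lowf B p \is a fin_num.
Proof.
move=> Yp; have [[ninf _] _ _] := low2P B.
by rewrite /lowf fin_numD /= fin_numElt ninf.
Qed.

Lemma lowf_ltyP p : (lowf B p < +oo)%E <-> domY B p.2.
Proof.
rewrite /lowf /domY /edom /=; split; last first.
  by move=> h; apply: lte_add_pinfty; rewrite ?ltry.
by case: (low2 B p.2) => [r| |] //= _; rewrite ?ltry ?ltNyr.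
Qed.

(** Outside [domY] the objective is [+oo], so the competitors may be restricted
to [domY], where it is real. *)
Lemma relaxed_solP theta x z : relaxed_sol B theta x z <->
  relaxed_argmin (domY B) (fine \o lowf B) (lowg B) theta x z.
Proof.
split=> [[gz /lowf_ltyP Yz zmin]|[Yz gz zmin]].
  split=> // z' Yz' gz'; apply: fine_le; [exact: lowf_fin..|exact: zmin].
split=> //; first exact/lowf_ltyP.
move=> z' gz'.
have [Yz'|] := pselect (domY B z'); last first.
  move/(contra_not (lowf_ltyP (x, z')).1)/negP.
  by rewrite ltey negbK => /eqP ->; rewrite leey.
rewrite -(fineK (lowf_fin (p := (x, z)) Yz)).
rewrite -(fineK (lowf_fin (p := (x, z')) Yz')) lee_fin.
exact: zmin.
Qed.

Lemma lower_solE x : lower_sol B x = relaxed_sol B 0 x.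
Proof.
rewrite /lower_sol /relaxed_sol; congr argmin; apply/seteqP; split=> z /=.
  by move/enorm_pospart_eq0 ->.
by move=> z0; apply/enorm_pospart_eq0/le_anti; rewrite z0 enorm_ge0.
Qed.

Local Notation F := (fine \o upf B).
Local Notation pen := (penalized (fine \o lowf B) (lowg B)).

Lemma penaltyE rho mu p z : domXY B p -> domY B z ->
  penalty B rho mu p z = (F p + rho * (pen mu p - pen mu (p.1, z)))%:E.
Proof.
move=> [Xp Yp] Yz; rewrite /penalty /penalty_low /penalized /=.
rewrite -(fineK (upf_fin Xp)) -(fineK (lowf_fin Yp)).
by rewrite -(fineK (lowf_fin (p := (p.1, z)) Yz)).
Qed.

(** The test point [(x0, w)] bounds the minimax value by [F (x0, w)], since its
penalty difference is nonpositive for every [z]; the two defects [eps] of the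
approximate solution then add up. *)
Lemma eps_optimal_gap rho mu eps u z : 0 < rho ->
  minimax_eps_optimal (domXY B) (domY B) (penalty B rho mu) eps u z ->
  forall x0 w z', domX B x0 ->
    penalty_argmin (domY B) (fine \o lowf B) (lowg B) mu x0 w -> domY B z' ->
  F u + rho * (pen mu u - pen mu (u.1, z')) <= F (x0, w) + 2 * eps.
Proof.
move=> rho0 [Vfin Du Dz maxle Vle] x0 w z' Xx0 [Yw wmin] Yz'.
have Dw : domXY B (x0, w) by split.
have VF : (minimax_value (domXY B) (domY B) (penalty B rho mu) <=
    (F (x0, w))%:E)%E.
  apply: (@le_trans _ _ (max_value (domY B) (penalty B rho mu) (x0, w))).
    by apply: ereal_inf_lbound; exists (x0, w).
  apply: ge_ereal_sup => _ [v Yv <-]; rewrite penaltyE // lee_fin.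
  by rewrite gerDl (mulr_ge0_le0 (ltW rho0)) // subr_le0 wmin.
have ub : (penalty B rho mu u z' <= max_value (domY B) (penalty B rho mu) u)%E.
  by apply: ereal_sup_ubound; exists z'.
rewrite -lee_fin -penaltyE //; apply: (le_trans ub).
move: maxle Vle; rewrite penaltyE //.
set P := F u + _; rewrite leeBlDr // => maxle.
rewrite -(fineK Vfin) -EFinB lee_fin => Vle.
apply: (le_trans maxle); rewrite -EFinD lee_fin.
move: VF; rewrite -(fineK Vfin) lee_fin.
lra.
Qed.

(** Monotonicity of the modulus turns its smallness at one positive level into a
bound for all smaller levels, [theta = 0] included. *)
Lemma assumption3_stable x0 z0 d : assumption3 B -> domX B x0 ->
  relaxed_sol B 0 x0 z0 -> 0 < d ->
  exists2 theta0, 0 < theta0 & forall theta, 0 <= theta <= theta0 ->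
    exists2 s, relaxed_sol B theta x0 s & `|z0 - s| <= d.
Proof.
move=> [thbar [omega [thbar0 _ omega_le omega0 dist_le]]] Xx0 z0min d0.
have [th [th0 thb omd]] : exists th, [/\ 0 < th, th <= thbar & omega th < d].
  have /cvgrPdist_lt/(_ _ d0) near_d := omega0.
  near (0 : R)^'+ => th; exists th; split.
  - by near: th; exact: nbhs_right_gt.
  - by near: th; exact: nbhs_right_le.
  rewrite (le_lt_trans (ler_norm _)) // -[omega th]subr0 distrC.
  by near: th.
exists th => // theta /andP[theta0 thetale].
have theta01 : 0 <= theta <= thbar by rewrite theta0 (le_trans thetale).
have := dist_le x0 z0 theta Xx0 z0min theta01.
have omd' : omega theta < d by apply: le_lt_trans omd; exact: omega_le.
move=> /le_lt_trans/(_ (_ : (_ < d%:E)%E)); rewrite lte_fin => /(_ omd').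
move=> /ereal_inf_lt[_ [s sP <-]]; rewrite lte_fin => sd.
by exists s => //; rewrite (le_trans (norm_le_enorm _)) // ltW.
Unshelve. all: by end_near. Qed.

End BilevelData.

(** * Accumulation points solve the bilevel problem *)

Theorem theorem4 (R : realType) (n m l : nat) (B : bilevel R n m l)
    (L1 Lt1 Lf Ltf Lg Ljg : R)
    (A1 : assumption1 B L1 Lt1)
    (A2 : assumption2 B Lf Ltf Lg Ljg)
    (A3 : assumption3 B)
    (rho mu eps : nat -> R)
    (rho_gt0 : forall k, 0 < rho k)
    (mu_gt0 : forall k, 0 < mu k)
    (eps_gt0 : forall k, 0 < eps k)
    (rho_oo : rho k @[k --> \oo] --> +oo)
    (mu_oo : mu k @[k --> \oo] --> +oo)
    (eps_0 : eps k @[k --> \oo] --> (0 : R))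
    (x : nat -> 'rV[R]_n) (y z : nat -> 'rV[R]_m)
    (xyz_opt : forall k,
      minimax_eps_optimal (domXY B) (domY B) (penalty B (rho k) (mu k)) (eps k)
        (x k, y k) (z k))
    (p : 'rV[R]_n * 'rV[R]_m)
    (p_acc : cluster ((x k, y k) @[k --> \oo]) p) :
  bilevel_optimal B p.
Proof.
have [_ _ _ _ [compactX compactY]] := A1.
have [[lipf liplow] [_ lipg] convg [zhat [zhatP _]]] := A2.
have [G [FG Goo Gp]] := cluster_subfilter p_acc.
have rhoG : rho k @[k --> G] --> +oo by move=> A /rho_oo/Goo.
have muG : mu k @[k --> G] --> +oo by move=> A /mu_oo/Goo.
have epsG : eps k @[k --> G] --> (0 : R) by move=> A /eps_0/Goo.
pose C := (`|Lf| + `|Ltf| + `|Lg|) * (n + m)%:R.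
have lipF : C.-lipschitz_(domX B `*` domY B) (fine \o upf B).
  apply: (elip_klipschitz _ lipf) => [q [Xq _]|]; first exact: upf_fin.
  by rewrite ler_wpM2r // -addrA lerDl addr_ge0.
have lipT : C.-lipschitz_(domX B `*` domY B) (fine \o lowf B).
  apply: (elip_klipschitz _ liplow) => [q [_ Yq]|]; first exact: lowf_fin.
  by rewrite ler_wpM2r // addrAC lerDr addr_ge0.
have lipG : C.-lipschitz_(domX B `*` domY B) (lowg B).
  by apply: (vlip_klipschitz lipg); rewrite ler_wpM2r // lerDr addr_ge0.
have u_dom k : (domX B `*` domY B) (x k, y k) by have [] := xyz_opt k.
have gap k := eps_optimal_gap (rho_gt0 k) (xyz_opt k).
have slaterB u : domX B u ->
    exists2 v, domY B v & forall i, lowg B (u, v) 0 i < 0.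
  by move=> /zhatP[Yv gv]; exists (zhat u).
have convexY a b t : domY B a -> domY B b -> 0 <= t <= 1 ->
    domY B (t *: a + (1 - t) *: b).
  by have [_ _ cv] := low2P B; exact: convex_edom.
have convexg u i a b t : domX B u -> 0 <= t <= 1 ->
    lowg B (u, t *: a + (1 - t) *: b) 0 i
      <= t * lowg B (u, a) 0 i + (1 - t) * lowg B (u, b) 0 i.
  move=> Xu; apply: (convex_functionE (h := fun v => lowg B (u, v) 0 i)).
  exact: convg.
have [Xp Yp] := limit_dom compactX compactY u_dom Gp.
split=> /=.
- rewrite lower_solE; apply/relaxed_solP.
  exact: (limit_lower_argmin compactX compactY lipF lipT lipG mu_gt0 u_dom gap
    rhoG muG epsG Gp slaterB convexY convexg).
- exact/upf_ltyP.
- move=> [x0 z0] /=; rewrite lower_solE => z0min.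
  have [Xx0|] := pselect (domX B x0); last first.
    move/(contra_not (upf_ltyP B (x0, z0)).1)/negP.
    by rewrite ltey negbK => /eqP ->; rewrite leey.
  rewrite -(fineK (upf_fin Xp)).
  rewrite -(fineK (upf_fin (B := B) (p := (x0, z0)) Xx0)) lee_fin.
  apply: (limit_upper_le compactX compactY lipF lipT lipG mu_gt0 u_dom gap
    muG epsG Gp Xx0 _ _); first exact/relaxed_solP.
  move=> d d0; have [th th0 thP] := assumption3_stable A3 Xx0 z0min d0.
  exists th => // theta /thP[s /relaxed_solP sP zs]; by exists s.
Qed.
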